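(* $\Lambda(R^+)$ is a weight-graded group: $\Lambda(R^+)=\bigoplus_{\alpha\in\Omega(R^+)}\Lambda(\alpha)$, where each $\Lambda(\alpha)$ is a graded subgroup of $\Lambda(R^+)$. Moreover, each $\Lambda(\alpha)$ is a subcomplex for $d$ and for $\delta$, so that there are direct sum decompositions of complexes $$(\Lambda(R^+),d)=\bigoplus_{\alpha\in\Omega(R^+)}(\Lambda(\alpha),d),\qquad (\Lambda(R^+),\delta)=\bigoplus_{\alpha\in\Omega(R^+)}(\Lambda(\alpha),\delta).$$ Consequently, for every abelian group $\mathbb F$, with $H_*^\alpha(R^+;\mathbb F)=H_*(\Lambda(\alpha)\otimes\mathbb F,d)$ and $H^*_\alpha(R^+;\mathbb F)=H^*(\Lambda(\alpha)\otimes\mathbb F,\delta)$, $$H_*(R^+;\mathbb F)=\bigoplus_{\alpha\in\Omega(R^+)}H_*^\alpha(R^+;\mathbb F),\qquad H^*(R^+;\mathbb F)=\bigoplus_{\alpha\in\Omega(R^+)}H^*_\alpha(R^+;\mathbb F).$$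
   Context: $R^+$ is the positive root system of a semisimple Lie algebra over $\mathbb C$ and $V$ is the real vector space spanned by $R^+$. The free abelian group on $R^+$ carries the Lie algebra structure over $\mathbb Z$ of the positive root system, with bracket of basis elements $[e,e']=\pm(e+e')$ (meaning $\pm$ the basis element $e+e'$) if $e+e'\in R^+$, and $[e,e']=0$ otherwise. $\Lambda(R^+)$ is the exterior algebra over $\mathbb Z$ on generators $(e)$, $e\in R^+$, graded by $|(e_1)\cdots(e_n)|=n$, $|1|=0$. The chain complex $(\Lambda(R^+),d)$ has $d(e)=0$ for $e\in R^+$ and, for $n>1$, $$d((e_1)\cdots(e_n))=\sum_{i<j}(-1)^{j-i-1}([e_i,e_j])(e_1)\cdots\widehat{(e_i)}\cdots\widehat{(e_j)}\cdots(e_n),$$ where hats denote omission, $(-e)=-(e)$ and $(0)=0$. $(\Lambda(R^+),\delta)$ is the dual cochain complex, regarded as the same group (via the basis of ordered products of generators) with the dual differential $\delta$. For an abelian group $\mathbb F$, $H_*(R^+;\mathbb F)=H_*(\Lambda(R^+)\otimes\mathbb F,d)$ and $H^*(R^+;\mathbb F)=H^*(\Lambda(R^+)\otimes\mathbb F,\delta)$. Weights: for $\sigma\subseteq R^+$, $\omega(\sigma)=\varrho-\sum_{e\in\sigma}e$ with $\varrho=\frac12\sum_{e\in R^+}e$; $\Omega(R^+)=\{\omega(\sigma)\mid\sigma\subseteq R^+\}\subset V$. Fix a total order on $R^+$ and identify a subset $\sigma\subseteq R^+$ with the ordered product $\prod_{e\in\sigma}(e)\in\Lambda(R^+)$ ($\emptyset$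 with $1$). For $\alpha\in\Omega(R^+)$, $\Lambda(\alpha)$ is the subgroup freely generated by all $\sigma\subseteq R^+$ with $\omega(\sigma)=\alpha$. *)

(* Defs.v *)
From HB Require Import structures.
From mathcomp Require Import all_boot all_order all_algebra.
From mathcomp Require Import zify ring.
From mathcomp Require Import generic_quotient ring_quotient.
From mathcomp Require Import boolp freeg.

Set Implicit Arguments.
Unset Strict Implicit.
Unset Printing Implicit Defensive.

Import Order.TTheory GRing.Theory Num.Theory.
Local Open Scope ring_scope.
Local Open Scope quotient_scope.

(* The exterior algebra over Z on generators indexed by 'I_n: the free abelian
   group on the subsets of 'I_n, a subset standing for the product of its
   elements in increasing order.  [extinv A B] is the number of transpositions
   needed to sort the juxtaposition of A and B. *)
Definition extalg (n : nat) : Type := {ffun {set 'I_n} -> int}.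

HB.instance Definition _ n := GRing.Zmodule.on (extalg n).

Section ExteriorAlgebra.
Variable n : nat.
Implicit Types (A B C : {set 'I_n}) (x y z : extalg n) (i j : 'I_n).

Definition ebas A : extalg n := [ffun B => (B == A)%:R].

Definition extinv A B : nat := (\sum_(a in A) \sum_(b in B) (b < a))%N.

Definition emul_bas A B : extalg n :=
  if [disjoint A & B] then ebas (A :|: B) *~ ((-1) ^+ extinv A B) else 0.

Definition emul x y : extalg n := \sum_A \sum_B emul_bas A B *~ (x A * y B).

Lemma ebasE A B : ebas A B = (B == A)%:R. Proof. by rewrite ffunE. Qed.

Lemma extalg_eqP x y : (forall A, x A = y A) <-> x = y.
Proof. by split=> [h|-> //]; apply/ffunP. Qed.

Lemma extD x y A : (x + y) A = x A + y A. Proof. exact: ffunE. Qed.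
Lemma extN x A : (- x) A = - x A. Proof. exact: ffunE. Qed.
Lemma ext0 A : (0 : extalg n) A = 0. Proof. exact: ffunE. Qed.
Lemma extB x y A : (x - y) A = x A - y A. Proof. by rewrite extD extN. Qed.
Lemma extMz x m A : (x *~ m) A = x A * m.
Proof.
rewrite -mulrzz; have h k : (x *+ k) A = x A *+ k.
  by elim: k => [|k ih]; rewrite ?mulr0n ?ext0 // !mulrS extD ih.
by case: m => k; rewrite ?NegzE ?mulrNz ?extN -!pmulrn h.
Qed.
Lemma ext_sum I (r : seq I) (P : pred I) (f : I -> extalg n) A :
  (\sum_(i <- r | P i) f i) A = \sum_(i <- r | P i) f i A.
Proof.
by elim/big_rec2: _ => [|i u v _ <-]; rewrite ?ext0 ?extD.
Qed.

Lemma ext_decomp x : x = \sum_A ebas A *~ x A.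
Proof.
apply/extalg_eqP => B; rewrite ext_sum (bigD1 B) //= big1 => [|A nAB].
  by rewrite extMz ebasE eqxx mul1r addr0.
by rewrite extMz ebasE eq_sym (negPf nAB) mul0r.
Qed.

Lemma ext_ind (P : extalg n -> Prop) :
  P 0 -> (forall x y, P x -> P y -> P (x + y)) -> (forall x, P x -> P (- x)) ->
  (forall A, P (ebas A)) -> forall x, P x.
Proof.
move=> P0 PD PN PB x; rewrite (ext_decomp x).
elim/big_ind: _ => // A _; have h k : P (ebas A *+ k).
  by elim: k => [|k ih]; rewrite ?mulr0n // mulrS; apply: PD.
by case: (x A) => k; rewrite ?NegzE ?mulrNz -!pmulrn //; apply: PN; apply: h.
Qed.

Lemma emulDl : left_distributive emul +%R.
Proof.
move=> x y z; rewrite /emul -big_split; apply: eq_bigr => A _.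
rewrite -big_split; apply: eq_bigr => B _ /=.
by rewrite extD mulrDl mulrzDr.
Qed.

Lemma emulDr : right_distributive emul +%R.
Proof.
move=> x y z; rewrite /emul -big_split; apply: eq_bigr => A _.
rewrite -big_split; apply: eq_bigr => B _ /=.
by rewrite extD mulrDr mulrzDr.
Qed.

Lemma emul0l x : emul 0 x = 0.
Proof. by apply: (addrI (emul 0 x)); rewrite -emulDl !addr0. Qed.
Lemma emul0r x : emul x 0 = 0.
Proof. by apply: (addrI (emul x 0)); rewrite -emulDr !addr0. Qed.
Lemma emulNl x y : emul (- x) y = - emul x y.
Proof. by apply/eqP; rewrite -addr_eq0 -emulDl addNr emul0l. Qed.
Lemma emulNr x y : emul x (- y) = - emul x y.
Proof. by apply/eqP; rewrite -addr_eq0 -emulDr addNr emul0r. Qed.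
Lemma emulMzr x y m : emul x (y *~ m) = emul x y *~ m.
Proof.
have h k : emul x (y *+ k) = emul x y *+ k.
  by elim: k => [|k ih]; rewrite ?mulr0n ?emul0r // !mulrS emulDr ih.
by case: m => k; rewrite ?NegzE ?mulrNz ?emulNr -!pmulrn h.
Qed.
Lemma emulMzl x y m : emul (x *~ m) y = emul x y *~ m.
Proof.
have h k : emul (x *+ k) y = emul x y *+ k.
  by elim: k => [|k ih]; rewrite ?mulr0n ?emul0l // !mulrS emulDl ih.
by case: m => k; rewrite ?NegzE ?mulrNz ?emulNl -!pmulrn h.
Qed.

Lemma emul_ebas A B : emul (ebas A) (ebas B) = emul_bas A B.
Proof.
rewrite /emul (bigD1 A) //= [X in _ + X]big1 ?addr0 => [|C nC].
  rewrite (bigD1 B) //= [X in _ + X]big1 ?addr0 => [|C nC].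
    by rewrite !ebasE !eqxx mulr1.
  by rewrite (ebasE B) (negPf nC) mulr0 mulr0z.
by apply: big1 => D _; rewrite ebasE (negPf nC) mul0r mulr0z.
Qed.

Lemma extinvUl A B C : [disjoint A & B] ->
  extinv (A :|: B) C = (extinv A C + extinv B C)%N.
Proof. by move=> dAB; rewrite /extinv -bigU //; apply: eq_bigl => i; rewrite !inE. Qed.

Lemma extinvUr A B C : [disjoint B & C] ->
  extinv A (B :|: C) = (extinv A B + extinv A C)%N.
Proof.
move=> dBC; rewrite /extinv -big_split; apply: eq_bigr => a _ /=.
by rewrite -bigU //; apply: eq_bigl => i; rewrite !inE.
Qed.

Lemma emulA : associative emul.
Proof.
move=> x y z.
pose lin := (emul0l, emul0r, emulDl, emulDr, emulNl, emulNr).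
elim/ext_ind: x => [|x x' h h'|x h|A]; rewrite ?lin ?h ?h' //.
elim/ext_ind: y => [|y y' h h'|y h|B]; rewrite ?lin ?h ?h' //.
elim/ext_ind: z => [|z z' h h'|z h|C]; rewrite ?lin ?h ?h' //.
rewrite !emul_ebas /emul_bas.
have [dBC|ndBC] := boolP [disjoint B & C]; last first.
  rewrite emul0r; case: ifPn => [dAB|_]; last by rewrite emul0l.
  rewrite emulMzl emul_ebas /emul_bas ifN ?mul0rz //.
  by rewrite disjoints_subset subUset -!disjoints_subset negb_and ndBC orbT.
rewrite emulMzr emul_ebas /emul_bas.
have -> : [disjoint A & B :|: C] = [disjoint A & B] && [disjoint A & C].
  by rewrite disjoint_sym disjoints_subset subUset -!disjoints_subset
     !(disjoint_sym A).
have [dAB|ndAB] /= := boolP [disjoint A & B]; last by rewrite emul0l mul0rz.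
rewrite emulMzl emul_ebas /emul_bas.
rewrite disjoints_subset subUset -!disjoints_subset dBC andbT.
case: ifPn => [dAC|_]; last by rewrite !mul0rz.
by rewrite -!mulrzA setUA extinvUl // extinvUr // -!exprD; congr (_ *~ _ ^+ _); lia.
Qed.

Lemma extinv0l A : extinv set0 A = 0%N.
Proof. by rewrite /extinv big_set0. Qed.
Lemma extinv0r A : extinv A set0 = 0%N.
Proof. by rewrite /extinv big1 // => a _; rewrite big_set0. Qed.

Lemma emul1l : left_id (ebas set0) emul.
Proof.
move=> x; elim/ext_ind: x => [|x x' h h'|x h|A]; rewrite ?emul0r ?emulDr ?emulNr ?h ?h' //.
by rewrite emul_ebas /emul_bas disjoints_subset sub0set set0U extinv0l.
Qed.
Lemma emul1r : right_id (ebas set0) emul.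
Proof.
move=> x; elim/ext_ind: x => [|x x' h h'|x h|A]; rewrite ?emul0l ?emulDl ?emulNl ?h ?h' //.
by rewrite emul_ebas /emul_bas disjoint_sym disjoints_subset sub0set setU0 extinv0r.
Qed.

HB.instance Definition _ :=
  GRing.Zmodule_isPzRing.Build (extalg n) emulA emul1l emul1r emulDl emulDr.

Definition egen i : extalg n := ebas [set i].

Lemma one_ebas : 1 = ebas set0. Proof. by []. Qed.

Lemma ebasM A B : ebas A * ebas B = emul_bas A B. Proof. exact: emul_ebas. Qed.

Lemma extinv1l i A : extinv [set i] A = (\sum_(b in A) (b < i))%N.
Proof. by rewrite /extinv big_set1. Qed.

Lemma extinv11 i j : extinv [set i] [set j] = (j < i)%N.
Proof. by rewrite extinv1l big_set1. Qed.

Lemma egenM_ebas i A :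
  egen i * ebas A =
  if i \in A then 0 else ebas (i |: A) *~ ((-1) ^+ extinv [set i] A).
Proof. by rewrite ebasM /emul_bas disjoints1; case: (i \in A). Qed.

Lemma egen_sqr i : egen i * egen i = 0.
Proof. by rewrite egenM_ebas set11. Qed.

Lemma egenC i j : egen i * egen j = - (egen j * egen i).
Proof.
have [->|nij] := eqVneq i j; first by rewrite egen_sqr oppr0.
rewrite !egenM_ebas !inE (eq_sym j) (negPf nij) !extinv11 [in RHS]setUC.
have: (i != j :> nat) by apply: contraNneq nij => /val_inj->.
by rewrite neq_ltn => /orP[] h; rewrite h (leq_gtF (ltnW h)) expr0 expr1 mulrNz ?opprK.
Qed.

Lemma prod_enum (A : {set 'I_n}) : \prod_(i <- enum A) egen i = ebas A.
Proof.
have: sorted (fun i j : 'I_n => i < j)%N (enum A).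
  rewrite {1}/enum_mem -enumT; apply: sorted_filter.
    by move=> j i k; exact: ltn_trans.
  by have := iota_ltn_sorted 0 n; rewrite -val_enum_ord sorted_map.
rewrite -[in RHS](set_enum A).
elim: (enum A) => [|i s ih] /= hs; first by rewrite big_nil set_nil.
rewrite big_cons ih ?(path_sorted hs) // egenM_ebas.
have /allP hi : all (fun j : 'I_n => i < j)%N s.
  by apply: order_path_min hs => j k l; exact: ltn_trans.
rewrite ifN; last by rewrite inE; apply/negP => /hi; rewrite ltnn.
rewrite set_cons extinv1l big1 // => j; rewrite inE => /hi h.
by rewrite (leq_gtF (ltnW h)).
Qed.

End ExteriorAlgebra.

Definition lie_ring (A : zmodType) (br : A -> A -> A) : Prop :=
  [/\ forall x, {morph br x : y z / y + z},
      forall z, {morph br^~ z : x y / x + y},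
      forall x, br x x = 0 &
      forall x y z, br x (br y z) + br y (br z x) + br z (br x y) = 0].

Definition freeZ (n : nat) : zmodType := {ffun 'I_n -> int}.

Definition zbas n (i : 'I_n) : freeZ n := [ffun j => (j == i)%:R].

(* The linear extension (v) of e |-> (e). *)
Definition elin n (v : freeZ n) : extalg n := \sum_i egen i *~ v i.

Section Differential.
Variables (n : nat) (br : freeZ n -> freeZ n -> freeZ n).

(* d((e_1)...(e_m)) for the word s = e_1 ... e_m in the generators.  Only its
   values on increasing words define [ediff]; [ediff_word] recovers the rest. *)
Definition dword (s : seq 'I_n) : extalg n :=
  let e (i : 'I_(size s)) := tnth (in_tuple s) i in
  \sum_(i < size s) \sum_(j < size s | (i < j)%N)
    (-1) ^+ (j - i - 1) *
      (elin (br (zbas (e i)) (zbas (e j))) *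
       \prod_(k < size s | (k != i) && (k != j)) egen (e k)).

Definition ediff (x : extalg n) : extalg n :=
  \sum_(A : {set 'I_n}) dword (enum A) *~ x A.

(* The transpose of [ediff] with respect to the basis [ebas]. *)
Definition ecodiff (x : extalg n) : extalg n :=
  [ffun A => \sum_(B : {set 'I_n}) x B * ediff (ebas A) B].

Lemma ediff_is_zmod_morphism : zmod_morphism ediff.
Proof.
move=> x y; rewrite /ediff -sumrB; apply: eq_bigr => A _.
by rewrite extB mulrzBr.
Qed.

HB.instance Definition _ :=
  GRing.isZmodMorphism.Build (extalg n) (extalg n) ediff ediff_is_zmod_morphism.

Lemma ecodiff_is_zmod_morphism : zmod_morphism ecodiff.
Proof.
move=> x y; apply/extalg_eqP => A; rewrite extB !ffunE -sumrB.
by apply: eq_bigr => B _; rewrite extB mulrBl.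
Qed.

HB.instance Definition _ :=
  GRing.isZmodMorphism.Build (extalg n) (extalg n) ecodiff
    ecodiff_is_zmod_morphism.

(* Contraction by a generator; with [elie] and [ediff_op] below it serves only
   to prove [ediff_word] and [ediff_sqr]. *)
Definition econtr (j : 'I_n) (x : extalg n) : extalg n :=
  [ffun S : {set 'I_n} => if j \in S then 0 else x (j |: S) * (-1) ^+ extinv [set j] S].

Lemma econtr_additive j : zmod_morphism (econtr j).
Proof.
move=> x y; apply/extalg_eqP => S; rewrite extB !ffunE.
by case: ifP => _; rewrite ?subr0 // -mulrBl.
Qed.

HB.instance Definition _ j :=
  GRing.isZmodMorphism.Build (extalg n) (extalg n) (econtr j) (econtr_additive j).

Lemma econtr_ebas j A :
  econtr j (ebas A) =
  if j \in A then ebas (A :\ j) *~ (-1) ^+ extinv [set j] (A :\ j) else 0.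
Proof.
apply/extalg_eqP => S; rewrite ffunE ebasE.
case: (boolP (j \in A)) => jA.
  rewrite extMz ebasE.
  case: ifP => [jS|jS].
    have /negPf -> : S != A :\ j by apply: contraTneq jS => ->; rewrite setD11.
    by rewrite mul0r.
  have -> : (j |: S == A) = (S == A :\ j).
    apply/eqP/eqP => [<-|->]; last by rewrite setD1K.
    by rewrite setU1K ?jS.
  by case: eqP => [->|_]; rewrite ?mul0r.
rewrite ext0; case: ifP => // _; rewrite (_ : (_ == A) = false) ?mul0r //.
by apply: contraNF jA => /eqP <-; rewrite setU11.
Qed.

Lemma ext_ebas_ind (P : extalg n -> Prop) :
  (forall x y, P x -> P y -> P (x - y)) -> P 1 ->
  (forall i x, P x -> P (egen i * x)) -> forall x, P x.
Proof.
move=> PB P1 Pg.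
have P0 : P 0 by rewrite -(subrr 1); apply: PB.
have PN x : P x -> P (- x) by move=> h; rewrite -sub0r; apply: PB.
elim/ext_ind => [//|x y hx hy|//|A].
  by rewrite -[y]opprK; apply: PB => //; apply: PN.
rewrite -prod_enum; elim: (enum A) => [|i s ih]; first by rewrite big_nil.
by rewrite big_cons; apply: Pg.
Qed.

Lemma extinvD1 (i j : 'I_n) (A : {set 'I_n}) : j \in A ->
  extinv [set i] A = ((j < i) + extinv [set i] (A :\ j))%N.
Proof. by move=> jA; rewrite !extinv1l (big_setD1 j). Qed.

Lemma extinvU1 (i j : 'I_n) (A : {set 'I_n}) : j \notin A ->
  extinv [set i] (j |: A) = ((j < i) + extinv [set i] A)%N.
Proof. by move=> jA; rewrite !extinv1l big_setU1. Qed.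

Lemma econtr_gen j i x :
  econtr j (egen i * x) = x *~ (i == j)%:R - egen i * econtr j x.
Proof.
elim/ext_ind: x => [|x y hx hy|x h|A].
- by rewrite mulr0 !raddf0 mulr0 mul0rz ?subr0 ?addr0.
- by rewrite mulrDr !raddfD /= hx hy mulrDr opprD mulrzDl addrACA.
- by rewrite mulrN !raddfN /= h mulrN mulNrz opprD.
rewrite egenM_ebas econtr_ebas.
have [<-{j}|nij] := eqVneq i j.
  case: (boolP (i \in A)) => iA.
    rewrite raddf0 mulrzAr egenM_ebas setD11 setD1K // -mulrzA -exprD addnn.
    by rewrite -mul2n exprM expr2 mulrNN mulr1 expr1n subrr.
  by rewrite raddfMz /= econtr_ebas setU11 setU1K // -mulrzA -exprD addnn
    -mul2n exprM expr2 mulrNN mulr1 expr1n mulr0 subr0.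
rewrite mulr0z sub0r.
case: (boolP (i \in A)) => iA.
  rewrite raddf0; case: ifP => jA; last by rewrite mulr0 oppr0.
  by rewrite mulrzAr egenM_ebas !inE nij iA mul0rz oppr0.
rewrite raddfMz /= econtr_ebas !inE eq_sym (negPf nij) /=.
case: ifP => jA; last by rewrite mul0rz mulr0 oppr0.
rewrite mulrzAr egenM_ebas !inE (negPf nij) (negPf iA) /=.
have -> : (i |: A) :\ j = i |: (A :\ j).
  by apply/setP => k; rewrite !inE; case: (k =P i) => [->|]; rewrite ?nij.
rewrite -!mulrzA -mulrNz -!exprD; congr (_ *~ _).
rewrite extinvU1 ?inE ?(negPf iA) ?andbF // (extinvD1 i jA).
have: (i != j :> nat) by apply: contraNneq nij => /val_inj->.
by rewrite neq_ltn => /orP[] h; rewrite h (leq_gtF (ltnW h)) !exprD ?expr0 ?expr1; ring.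
Qed.

Lemma econtr1 j : econtr j 1 = 0.
Proof. by rewrite one_ebas econtr_ebas inE. Qed.

Lemma elin_zbas (i : 'I_n) : elin (zbas i) = egen i.
Proof.
rewrite /elin (bigD1 i) //= big1 => [|j nj].
  by rewrite ffunE eqxx addr0.
by rewrite ffunE (negPf nj).
Qed.

Lemma elin_is_zmod_morphism : zmod_morphism (@elin n).
Proof.
move=> x y; rewrite /elin -sumrB; apply: eq_bigr => i _.
by rewrite !ffunE mulrzBr.
Qed.

HB.instance Definition _ :=
  GRing.isZmodMorphism.Build (freeZ n) (extalg n) (@elin n)
    elin_is_zmod_morphism.

Lemma elin_gen (v : freeZ n) (i : 'I_n) : elin v * egen i = - (egen i * elin v).
Proof.
rewrite /elin mulr_suml mulr_sumr -sumrN; apply: eq_bigr => j _.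
by rewrite mulrzAr mulrzAl egenC mulNrz.
Qed.

Lemma freeZ_decomp (v : freeZ n) : v = \sum_i zbas i *~ v i.
Proof.
apply/ffunP => k; rewrite sum_ffunE (bigD1 k) //= big1 => [|i nik].
  by rewrite addr0 ffunMzE ffunE eqxx intz.
by rewrite ffunMzE ffunE eq_sym (negPf nik) mul0rz.
Qed.

Lemma freeZ_ind (P : freeZ n -> Prop) :
  P 0 -> (forall x y, P x -> P y -> P (x - y)) -> (forall i, P (zbas i)) ->
  forall v, P v.
Proof.
move=> P0 PB Pz v.
have PN x : P x -> P (- x) by move=> h; rewrite -sub0r; apply: PB.
have PD x y : P x -> P y -> P (x + y).
  by move=> hx hy; rewrite -[y]opprK; apply: PB => //; apply: PN.
rewrite (freeZ_decomp v); elim/big_ind: _ => // i _.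
have h k : P (zbas i *+ k).
  by elim: k => [|k ih]; rewrite ?mulr0n // mulrS; apply: PD.
by case: (v i) => k; rewrite ?NegzE ?mulrNz -!pmulrn //; apply: PN; apply: h.
Qed.

Lemma elinB v w : elin (v - w) = elin v - elin w :> extalg n.
Proof. exact: raddfB. Qed.

Hypothesis brL : lie_ring br.

Definition elie v x := \sum_j elin (br v (zbas j)) * econtr j x.

Lemma lieDr x : {morph br x : y z / y + z}. Proof. by case: brL. Qed.
Lemma lieDl z : {morph br^~ z : x y / x + y}. Proof. by case: brL. Qed.
Lemma liexx x : br x x = 0. Proof. by case: brL. Qed.
Lemma lieC x y : br x y = - br y x.
Proof.
by apply/eqP; rewrite -addr_eq0 addrC; have := liexx (x + y); rewrite lieDr /= !lieDl !liexx add0r addr0 => ->.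
Qed.

Lemma lie_additive v : zmod_morphism (br v).
Proof.
move=> x y; have h0 : br v 0 = 0 by apply: (addrI (br v 0)); rewrite -lieDr !addr0.
by rewrite lieDr; congr (_ + _); apply/eqP; rewrite -addr_eq0 -lieDr addNr h0.
Qed.
HB.instance Definition _ v :=
  GRing.isZmodMorphism.Build (freeZ n) (freeZ n) (br v) (lie_additive v).

Lemma lieB v x y : br v (x - y) = br v x - br v y.
Proof. exact: raddfB. Qed.

Lemma elie_additive v : zmod_morphism (elie v).
Proof.
move=> x y; rewrite /elie -sumrB; apply: eq_bigr => j _.
by rewrite raddfB mulrBr.
Qed.
HB.instance Definition _ v :=
  GRing.isZmodMorphism.Build (extalg n) (extalg n) (elie v) (elie_additive v).

Lemma elieDl v w x : elie (v + w) x = elie v x + elie w x.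
Proof.
rewrite /elie -big_split; apply: eq_bigr => j _ /=.
by rewrite lieDl raddfD /= mulrDl.
Qed.
Lemma elieBl v w x : elie (v - w) x = elie v x - elie w x.
Proof. by apply/eqP; rewrite eq_sym subr_eq -elieDl subrK. Qed.

Lemma elie0l x : elie 0 x = 0.
Proof. by have := elieBl 0 0 x; rewrite !subrr. Qed.

Lemma elie1 v : elie v 1 = 0.
Proof. by rewrite /elie big1 // => j _; rewrite econtr1 mulr0. Qed.

Lemma elie_gen v a x :
  elie v (egen a * x) = elin (br v (zbas a)) * x + egen a * elie v x.
Proof.
rewrite /elie (eq_bigr (fun j => elin (br v (zbas j)) * x *~ (a == j)%:R +
   egen a * (elin (br v (zbas j)) * econtr j x))) => [|j _]; last first.
  by rewrite econtr_gen mulrBr mulrzAr [elin _ * (egen _ * _)]mulrA elin_gen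
    mulNr opprK mulrA.
rewrite big_split -mulr_sumr /= (bigD1 a) //= big1 => [|j nj].
  by rewrite eqxx addr0 mulr1z.
by rewrite eq_sym (negPf nj) mulr0z.
Qed.

Lemma elie_lin v w x :
  elie v (elin w * x) = elin (br v w) * x + elin w * elie v x.
Proof.
elim/freeZ_ind: w => [|y z hy hz|i]; last by rewrite elin_zbas elie_gen.
  by rewrite !raddf0 !mul0r !raddf0 ?addr0.
by rewrite !elinB lieB elinB !mulrBl raddfB /= hy hz opprD addrACA.
Qed.

Lemma zmod_shuffle (V : zmodType) (p q r s t u : V) :
  p - q + t + (q + r + (s + u)) = p + s + (r + (t + u)).
Proof.
rewrite [p - q + t]addrAC -[q + r + _]addrA [LHS]addrA subrK.
rewrite -!addrA; congr (_ + _).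
by rewrite [LHS]addrCA [t + (s + u)]addrCA [LHS]addrCA.
Qed.

Lemma elie_br v w x : elie (br v w) x + elie w (elie v x) = elie v (elie w x).
Proof.
elim/ext_ebas_ind: x => [x y hx hy||b x h].
- by rewrite !raddfB /= -hx -hy opprD addrACA.
- by rewrite !elie1 !raddf0 addr0.
rewrite !elie_gen !raddfD /= !elie_lin !elie_gen -h mulrDr.
have -> : br (br v w) (zbas b) = br v (br w (zbas b)) - br w (br v (zbas b)).
  have [_ _ _ jac] := brL; have /eqP := jac v w (zbas b).
  by rewrite (lieC (zbas b) v) raddfN /= (lieC (zbas b)) subr_eq0 => /eqP <-.
rewrite elinB mulrBl.
exact: zmod_shuffle.
Qed.


Definition ediff_op x :=
  \sum_(i < n) \sum_(j < n | (i < j)%N)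
    elin (br (zbas i) (zbas j)) * econtr j (econtr i x).

Lemma ediff_op_is_zmod_morphism : zmod_morphism ediff_op.
Proof.
move=> x y; rewrite /ediff_op -sumrB; apply: eq_bigr => i _.
by rewrite -sumrB; apply: eq_bigr => j _; rewrite !raddfB mulrBr.
Qed.
HB.instance Definition _ :=
  GRing.isZmodMorphism.Build (extalg n) (extalg n) ediff_op
    ediff_op_is_zmod_morphism.

Lemma ediff_op1 : ediff_op 1 = 0.
Proof.
rewrite /ediff_op big1 // => i _; rewrite big1 // => j _.
by rewrite econtr1 raddf0 mulr0.
Qed.

Lemma elie_split a x : elie (zbas a) x =
  \sum_(j < n | (a < j)%N) elin (br (zbas a) (zbas j)) * econtr j x -
  \sum_(i < n | (i < a)%N) elin (br (zbas i) (zbas a)) * econtr i x.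
Proof.
rewrite /elie (bigID (fun j : 'I_n => a < j)%N) /=; congr (_ + _).
rewrite -sumrN (bigID (fun j : 'I_n => j < a)%N) /= [X in _ + X]big1 => [|j]; last first.
  rewrite -!leqNgt => /andP[h1 h2].
  have -> : j = a by apply/val_inj/eqP; rewrite eqn_leq h1 h2.
  by rewrite liexx raddf0 mul0r.
rewrite addr0; apply: eq_big => [j|j h]; first by case: ltngtP.
by rewrite lieC raddfN mulNr.
Qed.

Lemma ediff_op_gen a x :
  ediff_op (egen a * x) = elie (zbas a) x - egen a * ediff_op x.
Proof.
have E i j : elin (br (zbas i) (zbas j)) * econtr j (econtr i (egen a * x)) =
  (elin (br (zbas i) (zbas j)) * econtr j x) *~ (i == a)%:R
  - (elin (br (zbas i) (zbas j)) * econtr i x) *~ (j == a)%:R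
  - egen a * (elin (br (zbas i) (zbas j)) * econtr j (econtr i x)).
  rewrite econtr_gen raddfB raddfMz /= econtr_gen opprB addrA addrAC.
  rewrite mulrDr mulrBr !mulrzAr (eq_sym a i) (eq_sym a j) addrAC.
  by rewrite [elin _ * (egen _ * _)]mulrA elin_gen mulNr -[egen _ * elin _ * _]mulrA addrAC.
rewrite {1}/ediff_op elie_split.
under eq_bigr => i _ do (under eq_bigr => j _ do rewrite E; rewrite sumrB sumrB).
rewrite !sumrB /=; congr (_ - _ - _).
- rewrite (bigD1 a) //= [X in _ + X]big1 ?addr0 => [|i nia].
    by apply: eq_bigr => j _; rewrite eqxx mulr1z.
  by apply: big1 => j _; rewrite (negPf nia) mulr0z.
- rewrite [RHS]big_mkcond /=; apply: eq_bigr => i _.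
  rewrite big_mkcond (bigD1 a) //= [X in _ + X]big1 ?addr0 => [|j nja].
    by rewrite eqxx mulr1z.
  by rewrite (negPf nja) mulr0z; case: ifP.
by rewrite mulr_sumr; apply: eq_bigr => i _; rewrite mulr_sumr.
Qed.

Lemma ediff_op_lin v x :
  ediff_op (elin v * x) = elie v x - elin v * ediff_op x.
Proof.
elim/freeZ_ind: v => [|y z hy hz|i]; last by rewrite elin_zbas ediff_op_gen.
  by rewrite elie0l !raddf0 !mul0r !raddf0 ?subr0 ?addr0.
rewrite elinB !mulrBl [LHS]raddfB /= hy hz elieBl !opprB.
by rewrite [LHS]addrACA [RHS]addrACA; congr (_ + _); rewrite addrC.
Qed.

Lemma ediff_op_elie v x : ediff_op (elie v x) = elie v (ediff_op x).
Proof.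
elim/ext_ebas_ind: x => [x y hx hy||a x h].
- by rewrite !raddfB /= hx hy.
- by rewrite elie1 ediff_op1 !raddf0.
rewrite elie_gen ediff_op_gen raddfD raddfB /= ediff_op_lin ediff_op_gen h.
by rewrite elie_gen -(elie_br v) opprD [LHS]addrACA.
Qed.

Lemma ediff_op_sqr x : ediff_op (ediff_op x) = 0.
Proof.
elim/ext_ebas_ind: x => [x y hx hy||a x h].
- by rewrite !raddfB /= hx hy subr0.
- by rewrite ediff_op1 raddf0.
by rewrite ediff_op_gen raddfB /= ediff_op_gen ediff_op_elie h mulr0 subr0 subrr.
Qed.

Lemma prod_lift (m : nat) (P : pred 'I_m.+1) (F : 'I_m.+1 -> extalg n) :
  \prod_(k < m.+1 | P k) F k =
  (if P ord0 then F ord0 else 1) * \prod_(k < m | P (fintype.lift ord0 k)) F (fintype.lift ord0 k).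
Proof. by rewrite big_mkcond big_ord_recl -big_mkcond. Qed.

Definition elie_word v (s : seq 'I_n) : extalg n :=
  let e (i : 'I_(size s)) := tnth (in_tuple s) i in
  \sum_(j < size s) (-1) ^+ j *
    (elin (br v (zbas (e j))) * \prod_(k < size s | k != j) egen (e k)).

Lemma tnth_lift0 a (s : seq 'I_n) (k : 'I_(size s)) :
  tnth (in_tuple (a :: s)) (fintype.lift ord0 k) = tnth (in_tuple s) k.
Proof. by rewrite !(tnth_nth a). Qed.

Lemma prod_tnth (s : seq 'I_n) :
  \prod_(k < size s) egen (tnth (in_tuple s) k) = \prod_(i <- s) egen i.
Proof. by rewrite [RHS]big_tnth. Qed.

Lemma elie_wordE v s : elie v (\prod_(i <- s) egen i) = elie_word v s.
Proof.
elim: s => [|a s ih]; first by rewrite big_nil elie1 /elie_word big_ord0.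
rewrite big_cons elie_gen ih /elie_word big_ord_recl; congr (_ + _).
  rewrite mul1r prod_lift eqxx mul1r; congr (elin _ * _).
  by rewrite -prod_tnth; apply: eq_bigr => k _; rewrite tnth_lift0.
rewrite mulr_sumr; apply: eq_bigr => j _.
rewrite prod_lift tnth_lift0 /= exprS mulN1r mulNr.
under [in RHS]eq_bigr => k _ do rewrite tnth_lift0.
under [in RHS]eq_bigl => k do rewrite (inj_eq fintype.lift_inj).
rewrite [elin _ * (egen _ * _)]mulrA elin_gen mulNr mulrN opprK -mulrA.
rewrite !mulrA; congr (_ * _ * _); elim: (j : nat) => [|k hk].
  by rewrite expr0 mulr1 mul1r.
by rewrite exprS mulN1r mulrN mulNr hk.
Qed.

Lemma ediff_op_wordE s : ediff_op (\prod_(i <- s) egen i) = dword s.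
Proof.
elim: s => [|a s ih]; first by rewrite big_nil ediff_op1 /dword big_ord0.
rewrite big_cons ediff_op_gen elie_wordE ih [RHS]/dword big_ord_recl.
congr (_ + _).
  rewrite [RHS]big_mkcond [RHS]big_ord_recl /= add0r; apply: eq_bigr => j _.
  rewrite subn0 /bump add1n subn1 /= tnth_lift0; congr (_ * (_ * _)).
  rewrite prod_lift eqxx mul1r; apply: eq_big => k; first by rewrite (inj_eq fintype.lift_inj).
  by rewrite tnth_lift0.
rewrite /dword mulr_sumr -sumrN; apply: eq_bigr => i _.
rewrite [RHS]big_mkcond [RHS]big_ord_recl /= add0r -[RHS]big_mkcond mulr_sumr -sumrN /=.
apply: eq_big => [j|j _]; first by rewrite /bump !add1n ltnS.
rewrite /bump !add1n subSS !tnth_lift0 prod_lift /=.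
under [in RHS]eq_bigr => k _ do rewrite tnth_lift0.
under [in RHS]eq_bigl => k do rewrite !(inj_eq fintype.lift_inj).
rewrite [elin _ * (egen _ * _)]mulrA elin_gen mulNr mulrN -[_ * elin _ * _]mulrA; congr (- _).
rewrite !mulrA; congr (_ * _ * _); elim: (j - i - 1)%N => [|k hk].
  by rewrite expr0 mulr1 mul1r.
by rewrite exprS mulN1r mulrN mulNr hk.
Qed.

Lemma ediff_opE x : ediff x = ediff_op x.
Proof.
rewrite [in RHS](ext_decomp x) raddf_sum; apply: eq_bigr => A _.
by rewrite raddfMz /= -prod_enum ediff_op_wordE.
Qed.

Lemma ediff_word s : ediff (\prod_(i <- s) egen i) = dword s.
Proof. by rewrite ediff_opE ediff_op_wordE. Qed.

Lemma ediff_sqr x : ediff (ediff x) = 0.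
Proof. by rewrite !ediff_opE ediff_op_sqr. Qed.

Lemma ecodiff_sqr x : ecodiff (ecodiff x) = 0.
Proof.
apply/extalg_eqP => A; rewrite ffunE ext0.
under eq_bigr => B _ do rewrite ffunE mulr_suml.
rewrite exchange_big big1 //= => C _.
under eq_bigr => B _ do rewrite -mulrA.
rewrite -mulr_sumr; apply/eqP; rewrite mulf_eq0; apply/orP; right; apply/eqP.
transitivity (ediff (ediff (ebas A)) C); last by rewrite ediff_sqr ext0.
rewrite [in RHS](ext_decomp (ediff (ebas A))) raddf_sum ext_sum.
by apply: eq_bigr => B _; rewrite raddfMz /= extMz.
Qed.

End Differential.

Section Subgroups.
Variable A : zmodType.

Record subgroup (W : zmodClosed A) : Type :=
  Subgroup { subgroup_val : A; _ : subgroup_val \in W }.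

HB.instance Definition _ W := [isSub for @subgroup_val W].
HB.instance Definition _ W := [Choice of subgroup W by <:].
HB.instance Definition _ W := [SubChoice_isSubZmodule of subgroup W by <:].

Definition generated (S : A -> Prop) : {pred A} :=
  [pred x | `[< forall W : zmodClosed A, (forall s, S s -> s \in W) -> x \in W >]].

Lemma generated_zmod_closed S : zmod_closed (generated S).
Proof.
split=> [|x y /asboolP hx /asboolP hy]; apply/asboolP => W hW.
  exact: rpred0.
by apply: rpredB; [apply: hx | apply: hy].
Qed.

HB.instance Definition _ S :=
  GRing.isZmodClosed.Build A (generated S) (generated_zmod_closed S).

Definition kernel (B : zmodType) (f : {additive A -> B}) : {pred A} :=
  [pred x | f x == 0].

Lemma kernel_zmod_closed (B : zmodType) (f : {additive A -> B}) :
  zmod_closed (kernel f).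
Proof.
split=> [|x y /eqP hx /eqP hy]; first by rewrite inE raddf0.
by rewrite inE raddfB hx hy subrr.
Qed.

HB.instance Definition _ (B : zmodType) (f : {additive A -> B}) :=
  GRing.isZmodClosed.Build A (kernel f) (kernel_zmod_closed f).

End Subgroups.

Section Tensor.
Variables A F : zmodType.

Inductive tensor_relation : {freeg (A * F) / int} -> Prop :=
| TensorDl a b f : tensor_relation (<< (a + b, f) >> - << (a, f) >> - << (b, f) >>)
| TensorDr a f g : tensor_relation (<< (a, f + g) >> - << (a, f) >> - << (a, g) >>).

Definition tensor : zmodType :=
  Quotient.quot (generated tensor_relation : zmodClosed {freeg (A * F) / int}).

Definition tens (a : A) (f : F) : tensor := \pi_tensor << (a, f) >>.
End Tensor.

Section TensorTheory.
Variable F : zmodType.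

Lemma tensDl (A : zmodType) (a b : A) (f : F) : tens (a + b) f = tens a f + tens b f.
Proof.
apply/eqP; rewrite -subr_eq0 opprD addrA -!raddfB; apply/eqP.
rewrite -(raddf0 (\pi_(tensor A F) : {additive _ -> _})) ; apply/eqP.
rewrite -Quotient.idealrBE subr0; apply/asboolP => W hW; apply: hW; exact: TensorDl.
Qed.

Lemma tensDr (A : zmodType) (a : A) (f g : F) : tens a (f + g) = tens a f + tens a g.
Proof.
apply/eqP; rewrite -subr_eq0 opprD addrA -!raddfB; apply/eqP.
rewrite -(raddf0 (\pi_(tensor A F) : {additive _ -> _})) ; apply/eqP.
rewrite -Quotient.idealrBE subr0; apply/asboolP => W hW; apply: hW; exact: TensorDr.
Qed.

Section Map.
Variables (A B : zmodType) (f : {additive A -> B}).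

Definition tmap_pre (x : {freeg (A * F) / int}) : tensor B F :=
  fglift (fun p => tens (f p.1) p.2 : zmodule (tensor B F)) x.

(* The map f (x) id, computed on a representative. *)
Definition tmap (t : tensor A F) : tensor B F := tmap_pre (repr t).

Lemma tmap_pre_is_zmod_morphism : zmod_morphism tmap_pre.
Proof.
have h := @lift_is_additive int (A * F)%type (zmodule (tensor B F)) (fun p => tens (f p.1) p.2).
exact: h.
Qed.

HB.instance Definition _ :=
  GRing.isZmodMorphism.Build {freeg (A * F) / int} (tensor B F) tmap_pre
    tmap_pre_is_zmod_morphism.

Lemma tmap_preU p : tmap_pre << p >> = tens (f p.1) p.2.
Proof. by rewrite /tmap_pre liftU scale1r. Qed.

Lemma tmap_pi x : tmap (\pi_(tensor A F) x) = tmap_pre x.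
Proof.
apply/eqP; rewrite -subr_eq0 -raddfB.
have: repr (\pi_(tensor A F) x) - x \in generated (@tensor_relation A F).
  by rewrite Quotient.idealrBE reprK.
move/asboolP => /(_ (kernel tmap_pre)); apply => _ [a b g|a g h];
  rewrite inE !raddfB /= !tmap_preU /= ?raddfD /= ?tensDl ?tensDr;
  by rewrite -addrA -opprD subrr.
Qed.

Lemma tmap_is_zmod_morphism : zmod_morphism tmap.
Proof.
move=> x y; rewrite -[x]reprK -[y]reprK -raddfB !tmap_pi; exact: raddfB.
Qed.

HB.instance Definition _ :=
  GRing.isZmodMorphism.Build (tensor A F) (tensor B F) tmap
    tmap_is_zmod_morphism.

Lemma tmap_tens a g : tmap (tens a g) = tens (f a) g.
Proof. by rewrite tmap_pi tmap_preU. Qed.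

End Map.

Lemma tensor_ind (A : zmodType) (P : tensor A F -> Prop) :
  P 0 -> (forall x y, P x -> P y -> P (x + y)) -> (forall x, P x -> P (- x)) ->
  (forall a g, P (tens a g)) -> forall t, P t.
Proof.
move=> P0 PD PN PU t; rewrite -[t]reprK.
elim/freeg_ind_dom0: (repr t) => [|k [a g] D _ _ hD]; first by rewrite raddf0.
rewrite raddfD; apply: (PD) => //=.
have -> : << k *g (a, g) >> = << (a, g) >> *~ k :> {freeg (A * F) / int}.
  by rewrite freegU_mulz intz.
rewrite raddfMz -/(tens a g); have h m : P (tens a g *+ m).
  by elim: m => [|m ih]; rewrite ?mulr0n // mulrS; apply: PD.
by case: k => m; rewrite ?NegzE ?mulrNz -!pmulrn //; apply: PN; apply: h.
Qed.

Lemma tmap_comp (A B C : zmodType) (f : {additive A -> B}) (g : {additive B -> C})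
  (h : {additive A -> C}) : (forall a, g (f a) = h a) ->
  forall t, tmap g (tmap f t) = tmap h t.
Proof.
move=> gf; elim/tensor_ind => [|x y hx hy|x hx|a z].
- by rewrite !raddf0.
- by rewrite !raddfD /= hx hy.
- by rewrite !raddfN /= hx.
- by rewrite !tmap_tens gf.
Qed.

End TensorTheory.

Arguments tmap F {A B} f t.

(* A graded group with a differential; [cdeg k] is the set of homogeneous
   elements of degree k. *)
Record gcomplex := GComplex {
  cgrp :> zmodType;
  cdeg : nat -> cgrp -> Prop;
  cdif : {additive cgrp -> cgrp};
  cdif_sqr : forall x, cdif (cdif x) = 0
}.

Arguments cdif {g}.

Record chain_map (C D : gcomplex) := ChainMap {
  cmap :> {additive C -> D};
  cmap_dif : forall x, cmap (cdif x) = cdif (cmap x)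
}.

Definition is_subcomplex (C : gcomplex) (W : zmodClosed C) : Prop :=
  forall x, x \in W -> cdif x \in W.

Section Subcomplex.
Variables (C : gcomplex) (W : zmodClosed C).
Hypothesis hW : is_subcomplex W.

Definition sub_dif (x : subgroup W) : subgroup W :=
  Subgroup (hW (valP x)).

Lemma sub_dif_is_zmod_morphism : zmod_morphism sub_dif.
Proof. by move=> x y; apply/val_inj; rewrite /= !raddfB. Qed.

HB.instance Definition _ :=
  GRing.isZmodMorphism.Build (subgroup W) (subgroup W) sub_dif
    sub_dif_is_zmod_morphism.

Lemma sub_dif_sqr x : sub_dif (sub_dif x) = 0.
Proof. by apply/val_inj; rewrite [RHS]raddf0 /= cdif_sqr. Qed.

Definition subcomplex : gcomplex :=
  @GComplex (subgroup W) (fun k x => cdeg k (val x)) sub_dif sub_dif_sqr.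

Definition subcomplex_incl : chain_map subcomplex C :=
  @ChainMap subcomplex C (val : {additive subgroup W -> C}) (fun=> erefl).

End Subcomplex.

Section TensorComplex.
Variable F : zmodType.

Lemma tensor_dif_sqr (C : gcomplex) (t : tensor C F) :
  tmap F (@cdif C) (tmap F (@cdif C) t) = 0.
Proof.
elim/tensor_ind: t => [|x y hx hy|x hx|a g].
- by rewrite !raddf0.
- by rewrite !raddfD /= hx hy addr0.
- by rewrite !raddfN /= hx oppr0.
rewrite !tmap_tens cdif_sqr.
by apply: (addrI (tens 0 g)); rewrite -tensDl !addr0.
Qed.

(* C (x) F, an element being homogeneous of degree k when it is a sum of
   pure tensors c (x) f with c homogeneous of degree k. *)
Definition tensor_complex (C : gcomplex) : gcomplex :=
  @GComplex (tensor C F)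
    (fun k t => exists2 s : seq (C * F),
       (forall p, p \in s -> cdeg k p.1) & t = \sum_(p <- s) tens p.1 p.2)
    (tmap F (@cdif C)) (@tensor_dif_sqr C).

Lemma tensor_map_dif (C D : gcomplex) (f : chain_map C D) t :
  tmap F f (cdif (t : tensor_complex C)) = cdif (tmap F f t : tensor_complex D).
Proof.
rewrite /= (tmap_comp (h := f \o cdif : {additive _ -> _})) //.
rewrite (tmap_comp (h := f \o cdif : {additive _ -> _})) //.
by move=> a /=; rewrite cmap_dif.
Qed.

Definition tensor_map (C D : gcomplex) (f : chain_map C D) :
    chain_map (tensor_complex C) (tensor_complex D) :=
  @ChainMap (tensor_complex C) (tensor_complex D) (tmap F f) (tensor_map_dif f).

End TensorComplex.

Section Homology.
Implicit Types C D : gcomplex.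

Definition cycles C : zmodType := subgroup (kernel (@cdif C) : zmodClosed C).

Definition boundaries C : {pred cycles C} :=
  [pred z | `[< exists w : C, val z = cdif w >]].

Lemma boundaries_zmod_closed C : zmod_closed (@boundaries C).
Proof.
split=> [|x y /asboolP[u hu] /asboolP[v hv]]; apply/asboolP.
  by exists 0; rewrite !raddf0.
by exists (u - v); rewrite !raddfB /= hu hv.
Qed.

HB.instance Definition _ C :=
  GRing.isZmodClosed.Build (cycles C) (@boundaries C) (@boundaries_zmod_closed C).

Definition homology C : zmodType :=
  Quotient.quot (@boundaries C : zmodClosed (cycles C)).

Definition hclass C (z : cycles C) : homology C := \pi_(homology C) z.

(* The degree k part of the homology: classes of homogeneous cycles. *)
Definition homology_deg C (k : nat) (h : homology C) : Prop :=
  exists2 z : cycles C, cdeg k (val z) & h = hclass z.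

Section Map.
Variables (C D : gcomplex) (f : chain_map C D).

Lemma cycle_map_subproof (z : cycles C) : f (val z) \in kernel (@cdif D).
Proof. by case: z => z /= /eqP hz; rewrite inE -cmap_dif hz raddf0. Qed.

Definition cycle_map (z : cycles C) : cycles D := Subgroup (cycle_map_subproof z).

Definition homology_map (h : homology C) : homology D :=
  hclass (cycle_map (repr h)).

Lemma cycle_mapB x y : cycle_map (x - y) = cycle_map x - cycle_map y.
Proof. by apply/val_inj; rewrite /= !raddfB. Qed.

Lemma homology_map_class z : homology_map (hclass z) = hclass (cycle_map z).
Proof.
apply/eqP; rewrite -Quotient.idealrBE -cycle_mapB.
have: repr (hclass z) - z \in @boundaries C by rewrite Quotient.idealrBE reprK.
move=> /asboolP[w hw]; apply/asboolP; exists (f w).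
by rewrite /= -cmap_dif -hw.
Qed.

Lemma homology_map_is_zmod_morphism : zmod_morphism homology_map.
Proof.
move=> x y; rewrite -[x]reprK -[y]reprK -raddfB !homology_map_class cycle_mapB.
exact: raddfB.
Qed.

HB.instance Definition _ :=
  GRing.isZmodMorphism.Build (homology C) (homology D) homology_map
    homology_map_is_zmod_morphism.

End Map.
End Homology.

(* The maps [j i] exhibit B as the direct sum of the finitely many A i. *)
Definition is_direct_sum (I : finType) (A : I -> zmodType) (B : zmodType)
    (j : forall i, {additive A i -> B}) : Prop :=
  forall b, exists! a : (forall i, A i), b = \sum_i j i (a i).

Definition is_graded_direct_sum (I : finType) (A : I -> zmodType) (B : zmodType)
    (degA : forall i, nat -> A i -> Prop) (degB : nat -> B -> Prop)
    (j : forall i, {additive A i -> B}) : Prop :=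
  is_direct_sum j /\
  forall k (a : forall i, A i),
    degB k (\sum_i j i (a i)) <-> forall i, degA i k (a i).

Definition is_complex_direct_sum (I : finType) (C : I -> gcomplex) (D : gcomplex)
    (j : forall i, chain_map (C i) D) : Prop :=
  is_graded_direct_sum (fun i => @cdeg (C i)) (@cdeg D)
    (fun i => j i : {additive C i -> D}).

Definition is_homology_direct_sum (I : finType) (C : I -> gcomplex) (D : gcomplex)
    (j : forall i, chain_map (C i) D) : Prop :=
  is_graded_direct_sum (fun i => @homology_deg (C i)) (@homology_deg D)
    (fun i => homology_map (j i) : {additive homology (C i) -> homology D}).

Section LieAlgebras.
Variables (K : fieldType) (L : vectType K) (br : L -> L -> L).
Implicit Types U W : {vspace L}.

Definition lie_algebra : Prop :=
  lie_ring br /\ forall c x y, br (c *: x) y = c *: br x y.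

Definition lie_span U W : {vspace L} :=
  <<[seq br x y | x <- vbasis U, y <- vbasis W]>>%VS.

Definition lie_ideal U : Prop := forall x y, y \in U -> br x y \in U.

Definition lie_solvable U : Prop :=
  exists k, iter k (fun W => lie_span W W) U = 0%VS.

Definition lie_nilpotent U : Prop := exists k, iter k (lie_span U) U = 0%VS.

Definition semisimple : Prop :=
  forall U, lie_ideal U -> lie_solvable U -> U = 0%VS.

Definition cartan_subalgebra U : Prop :=
  [/\ forall x y, x \in U -> y \in U -> br x y \in U,
      lie_nilpotent U &
      forall x, (forall y, y \in U -> br x y \in U) -> x \in U].

Definition is_root (H : {vspace L}) (a : 'Hom(subvs_of H, K^o)) : Prop :=
  a != 0 /\ exists2 x, x != 0 & forall h : subvs_of H, br (vsval h) x = a h *: x.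

(* The set of positive roots, listed in increasing order for a fixed total
   order.  The real vector space spanned by the roots is a subspace of the dual
   of H, so weights are taken in that dual. *)
Definition positive_roots (H : {vspace L}) (Rp : seq 'Hom(subvs_of H, K^o)) : Prop :=
  [/\ uniq Rp,
      forall a, a \in Rp -> is_root a,
      forall a, is_root a -> (- a \in Rp) = (a \notin Rp) &
      forall a b, a \in Rp -> b \in Rp -> is_root (a + b) -> a + b \in Rp].

End LieAlgebras.

Section Weights.
Variables (n : nat).

(* [e, e'] = +-(e + e') if e + e' is a positive root, and 0 otherwise. *)
Definition root_bracket (V : zmodType) (Rp : n.-tuple V)
    (br : freeZ n -> freeZ n -> freeZ n) : Prop :=
  forall i j : 'I_n,
    (forall k, tnth Rp i + tnth Rp j = tnth Rp k ->
       br (zbas i) (zbas j) = zbas k \/ br (zbas i) (zbas j) = - zbas k) /\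
    (tnth Rp i + tnth Rp j \notin Rp -> br (zbas i) (zbas j) = 0).

(* The subgroup generated by the ordered products of the subsets in P. *)
Definition espan (P : pred {set 'I_n}) : {pred extalg n} :=
  [pred x : extalg n | x == \sum_(A | P A) ebas A *~ x A].

Lemma espan_zmod_closed P : zmod_closed (espan P).
Proof.
split=> [|x y /eqP hx /eqP hy]; apply/eqP.
  by rewrite big1 // => A _; rewrite ext0 mulr0z.
rewrite {1}hx {1}hy -sumrB; apply: eq_bigr => A _.
by rewrite extB mulrzBr.
Qed.

HB.instance Definition _ P :=
  GRing.isZmodClosed.Build (extalg n) (espan P) (espan_zmod_closed P).

Definition edeg (k : nat) : {pred extalg n} := espan (fun A => #|A| == k).

(* Homogeneous component of degree k. *)
Definition ecomp (k : nat) (x : extalg n) : extalg n :=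
  \sum_(A : {set 'I_n} | #|A| == k) ebas A *~ x A.

Definition graded_subgroup (W : zmodClosed (extalg n)) : Prop :=
  forall x k, x \in W -> ecomp k x \in W.

Definition weight (K : fieldType) (V : lmodType K) (Rp : n.-tuple V)
    (s : {set 'I_n}) : V :=
  2^-1 *: \sum_i tnth Rp i - \sum_(i in s) tnth Rp i.

(* The finite type of the weights of subsets. *)
Definition Omega (K : fieldType) (V : lmodType K) (Rp : n.-tuple V) : finType :=
  seq_sub [seq weight Rp s | s : {set 'I_n}].

Definition Lambda (K : fieldType) (V : lmodType K) (Rp : n.-tuple V)
    (a : Omega Rp) : zmodClosed (extalg n) :=
  espan (fun s => weight Rp s == ssval a).

Definition ext_chain (br : freeZ n -> freeZ n -> freeZ n) (brL : lie_ring br) :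
    gcomplex :=
  @GComplex (extalg n) (fun k x => x \in edeg k) (ediff br) (ediff_sqr brL).

Definition ext_cochain (br : freeZ n -> freeZ n -> freeZ n) (brL : lie_ring br) :
    gcomplex :=
  @GComplex (extalg n) (fun k x => x \in edeg k) (ecodiff br) (ecodiff_sqr brL).

End Weights.

(* Main.v *)
(** The bracket of two positive roots is a multiple of their sum, so
    contracting [e] and [e'] and multiplying by [[e, e']] leaves the weight of
    a basis element unchanged: the matrix of [d] in the basis of ordered
    products is block diagonal with respect to weights, and so is its transpose
    [delta].  The inclusions of the blocks and the projections onto them are
    chain maps that form a biproduct system; such a system is preserved by every
    additive functor, in particular by [- (x) F] and by homology. *)

From HB Require Import structures.
Require Import Defs.
From mathcomp Require Import all_boot all_order all_algebra.
From mathcomp Require Import generic_quotient boolp.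
From mathcomp Require Import reals complex.

Set Implicit Arguments.
Unset Strict Implicit.
Unset Printing Implicit Defensive.

Import GRing.Theory.
Local Open Scope ring_scope.

(** * Biproduct systems of abelian groups and of complexes *)

Definition biproduct (I : finType) (A : I -> zmodType) (B : zmodType)
    (j : forall i, {additive A i -> B}) (p : forall i, {additive B -> A i}) :=
  [/\ forall i x, p i (j i x) = x,
      forall i k x, i != k -> p i (j k x) = 0 &
      forall b, \sum_i j i (p i b) = b].

Section Biproduct.
Variables (I : finType) (A : I -> zmodType) (B : zmodType).
Variables (j : forall i, {additive A i -> B}) (p : forall i, {additive B -> A i}).
Hypothesis jp : biproduct j p.

Lemma biproduct_sumK (a : forall i, A i) i : p i (\sum_k j k (a k)) = a i.
Proof.
have [jK j0 _] := jp; rewrite raddf_sum (bigD1 i) //= jK big1 ?addr0 // => k.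
by rewrite eq_sym => /j0 ->.
Qed.

Lemma biproduct_direct_sum : is_direct_sum j.
Proof.
have [_ _ pK] := jp; move=> b; exists (fun i => p i b); split=> [|a ->].
  by rewrite pK.
by apply: functional_extensionality_dep => i; rewrite biproduct_sumK.
Qed.

(** The projections read off the degree of each component of a homogeneous sum; conversely, closure
    of [degB] under sums reassembles homogeneous components. *)
Lemma biproduct_graded_direct_sum (degA : forall i, nat -> A i -> Prop)
    (degB : nat -> B -> Prop) :
  (forall k, degB k 0) ->
  (forall k x y, degB k x -> degB k y -> degB k (x + y)) ->
  (forall i k x, degA i k x -> degB k (j i x)) ->
  (forall i k x, degB k x -> degA i k (p i x)) ->
  is_graded_direct_sum degA degB j.
Proof.
move=> deg0 degD degj degp; split; first exact: biproduct_direct_sum.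
move=> k a; split=> [h i|h].
  by rewrite -(biproduct_sumK a i); apply: degp.
by elim/big_ind: _ => [||i _]; [apply: deg0 | apply: degD | apply: degj].
Qed.

End Biproduct.

(** In a [gcomplex] the degree predicate is arbitrary, so closure under finite sums has to be asked
    for separately. *)
Definition deg_add_closed (C : gcomplex) :=
  (forall k, cdeg (g := C) k 0) /\
  (forall k (x y : C), cdeg k x -> cdeg k y -> cdeg k (x + y)).

Definition deg_preserving (C D : gcomplex) (f : C -> D) :=
  forall k x, cdeg k x -> cdeg k (f x).

Definition complex_biproduct (I : finType) (C : I -> gcomplex) (D : gcomplex)
    (j : forall i, chain_map (C i) D) (p : forall i, chain_map D (C i)) :=
  [/\ biproduct (fun i => j i : {additive C i -> D})
                (fun i => p i : {additive D -> C i}),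
      deg_add_closed D, forall i, deg_preserving (j i) &
      forall i, deg_preserving (p i)].

(** Only the [j i] are assumed to be chain maps. Differentiating [x = \sum_k j k (p k x)] gives
    [\sum_k j k (cdif (p k x))], and [p i] extracts the term of index [i]. *)
Lemma biproduct_proj_dif (I : finType) (C : I -> gcomplex) (D : gcomplex)
    (j : forall i, chain_map (C i) D) (p : forall i, {additive D -> C i}) :
  biproduct (fun i => j i : {additive C i -> D}) p ->
  forall i x, p i (cdif x) = cdif (p i x).
Proof.
move=> jp i x; have [_ _ pK] := jp.
rewrite -[in LHS](pK x) raddf_sum.
under eq_bigr => k _ do rewrite /= -cmap_dif.
exact: (biproduct_sumK jp (fun k => cdif (p k x))).
Qed.

Lemma complex_biproduct_direct_sum (I : finType) (C : I -> gcomplex)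
    (D : gcomplex) (j : forall i, chain_map (C i) D)
    (p : forall i, chain_map D (C i)) :
  complex_biproduct j p -> is_complex_direct_sum j.
Proof.
by case=> jp [d0 dD] dj dp; apply: (biproduct_graded_direct_sum jp).
Qed.

(** Upgrades a splitting of the underlying group to one of complexes: the projections are
    automatically chain maps because the inclusions are. *)
Lemma subcomplex_biproduct (I : finType) (C : gcomplex)
    (W : I -> zmodClosed C) (sW : forall i, is_subcomplex (W i))
    (p : forall i, {additive C -> subgroup (W i)}) :
  biproduct (fun i => val : {additive subgroup (W i) -> C}) p ->
  deg_add_closed C ->
  (forall i k x, cdeg k x -> cdeg k (val (p i x))) ->
  exists q : forall i, chain_map C (subcomplex (sW i)),
    complex_biproduct (fun i => subcomplex_incl (sW i)) q.
Proof.
move=> jp dC dp.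
have pd i x : p i (cdif x) = cdif (p i x : subcomplex (sW i)).
  exact: (biproduct_proj_dif (j := fun i => subcomplex_incl (sW i)) jp).
exists (fun i => ChainMap (D := subcomplex (sW i)) (pd i)); split.
- exact: jp.
- exact: dC.
- by move=> i k x.
- exact: dp.
Qed.

(** * Tensoring a biproduct system with an abelian group *)

Section TensorBiproduct.
Variable F : zmodType.

Lemma tens0l (A : zmodType) (g : F) : tens (0 : A) g = 0.
Proof. by apply: (addrI (tens 0 g)); rewrite -tensDl !addr0. Qed.

Lemma tens_sum (A : zmodType) (I : Type) (r : seq I) (a : I -> A) (g : F) :
  tens (\sum_(i <- r) a i) g = \sum_(i <- r) tens (a i) g.
Proof.
elim: r => [|i r ih]; first by rewrite !big_nil tens0l.
by rewrite !big_cons tensDl ih.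
Qed.

(** All three identities are additive in the tensor, so it suffices to check them on pure tensors,
    where they come from [A] and [B]. *)
Lemma tmap_biproduct (I : finType) (A : I -> zmodType) (B : zmodType)
    (j : forall i, {additive A i -> B}) (p : forall i, {additive B -> A i}) :
  biproduct j p ->
  biproduct (fun i => tmap F (j i) : {additive _ -> _})
            (fun i => tmap F (p i) : {additive _ -> _}).
Proof.
case=> jK j0 pK; split=> [i t|i k t ik|t] /=; elim/tensor_ind: t.
- by rewrite !raddf0.
- by move=> x y hx hy; rewrite !raddfD /= hx hy.
- by move=> x hx; rewrite !raddfN /= hx.
- by move=> a g; rewrite !tmap_tens jK.
- by rewrite !raddf0.
- by move=> x y hx hy; rewrite !raddfD /= hx hy addr0.
- by move=> x hx; rewrite !raddfN /= hx oppr0.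
- by move=> a g; rewrite !tmap_tens j0 // tens0l.
- by rewrite big1 // => i _; rewrite !raddf0.
- move=> x y hx hy; rewrite -[in RHS]hx -[in RHS]hy -big_split /=.
  by apply: eq_bigr => i _; rewrite !raddfD.
- move=> x hx; rewrite -[in RHS]hx -sumrN.
  by apply: eq_bigr => i _; rewrite !raddfN.
- move=> a g; rewrite -[in RHS](pK a) tens_sum.
  by apply: eq_bigr => i _; rewrite !tmap_tens.
Qed.

Lemma tensor_deg_add_closed (C : gcomplex) :
  deg_add_closed (tensor_complex F C).
Proof.
split=> [k|k x y [s hs ->] [t ht ->]]; first by exists [::]; rewrite ?big_nil.
exists (s ++ t); last by rewrite big_cat.
by move=> q; rewrite mem_cat => /orP[/hs|/ht].
Qed.

Lemma tensor_map_deg_preserving (C D : gcomplex) (f : chain_map C D) :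
  deg_preserving f -> deg_preserving (tensor_map F f).
Proof.
move=> hf k x [s hs ->]; exists [seq (f q.1, q.2) | q <- s].
  by move=> _ /mapP[q /hs hq ->]; apply: hf.
by rewrite raddf_sum big_map; apply: eq_bigr => q _; rewrite /= tmap_tens.
Qed.

Lemma tensor_complex_biproduct (I : finType) (C : I -> gcomplex) (D : gcomplex)
    (j : forall i, chain_map (C i) D) (p : forall i, chain_map D (C i)) :
  complex_biproduct j p ->
  complex_biproduct (fun i => tensor_map F (j i)) (fun i => tensor_map F (p i)).
Proof.
case=> jp dD dj dp; split.
- exact: tmap_biproduct jp.
- exact: tensor_deg_add_closed.
- by move=> i; apply: tensor_map_deg_preserving.
- by move=> i; apply: tensor_map_deg_preserving.
Qed.

End TensorBiproduct.

(** * Biproduct systems in homology *)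

Section HomologyBiproduct.

Lemma hclass_is_zmod_morphism (C : gcomplex) : zmod_morphism (@hclass C).
Proof. by move=> x y; rewrite /hclass raddfB. Qed.

HB.instance Definition _ (C : gcomplex) :=
  GRing.isZmodMorphism.Build (cycles C) (homology C) (@hclass C)
    (@hclass_is_zmod_morphism C).

Lemma hclass_repr (C : gcomplex) (h : homology C) : hclass (repr h) = h.
Proof. exact: reprK. Qed.

(** The identities already hold between representing cycles, not merely up to boundaries. *)
Lemma homology_biproduct (I : finType) (C : I -> gcomplex) (D : gcomplex)
    (j : forall i, chain_map (C i) D) (p : forall i, chain_map D (C i)) :
  biproduct (fun i => j i : {additive C i -> D})
            (fun i => p i : {additive D -> C i}) ->
  biproduct
    (fun i => homology_map (j i) : {additive homology (C i) -> homology D})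
    (fun i => homology_map (p i) : {additive homology D -> homology (C i)}).
Proof.
case=> jK j0 pK; split=> [i h|i k h ik|h] /=; rewrite -(hclass_repr h).
- rewrite !homology_map_class; congr hclass; apply: val_inj; exact: jK.
- rewrite !homology_map_class -[RHS](raddf0 (@hclass (C i))); congr hclass.
  by apply: val_inj; apply: j0.
- under eq_bigr => i _ do rewrite !homology_map_class.
  rewrite -raddf_sum; congr hclass; apply: val_inj.
  by rewrite raddf_sum /=; apply: pK.
Qed.

Lemma homology_map_deg (C D : gcomplex) (f : chain_map C D) :
  deg_preserving f ->
  forall k h, homology_deg k h -> homology_deg k (homology_map f h).
Proof.
move=> hf k h [z hz ->]; exists (Defs.cycle_map f z); first exact: hf.
by rewrite homology_map_class.
Qed.

Lemma homology_biproduct_direct_sum (I : finType) (C : I -> gcomplex)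
    (D : gcomplex) (j : forall i, chain_map (C i) D)
    (p : forall i, chain_map D (C i)) :
  complex_biproduct j p -> is_homology_direct_sum j.
Proof.
case=> jp [d0 dD] dj dp.
apply: (biproduct_graded_direct_sum (homology_biproduct jp)).
- by move=> k; exists 0; [apply: d0 | rewrite raddf0].
- move=> k x y [u hu ->] [v hv ->]; exists (u + v); last by rewrite raddfD.
  exact: dD.
- by move=> i k x; apply: homology_map_deg.
- by move=> i k x; apply: homology_map_deg.
Qed.

End HomologyBiproduct.

(** * Spans of basis elements and coordinate projections *)

Section Span.
Variable n : nat.
Implicit Types (P Q : pred {set 'I_n}) (x y : extalg n) (A : {set 'I_n}).

Lemma espanP P x : reflect (forall A, ~~ P A -> x A = 0) (x \in espan P).
Proof.
apply: (iffP eqP) => [-> A nPA|h].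
  rewrite ext_sum big1 // => B PB; rewrite extMz ebasE.
  by case: eqP PB nPA => [->->|]; rewrite ?mul0r.
rewrite [LHS]ext_decomp (bigID P) /= [X in _ + X]big1 ?addr0 // => A nPA.
by rewrite h // mulr0z.
Qed.

Lemma ebas_span P A : P A -> ebas A \in espan P.
Proof.
move=> PA; apply/espanP => B nPB; rewrite ebasE.
by case: eqP nPB => // ->; rewrite PA.
Qed.

Definition eproj P x : extalg n := [ffun A => if P A then x A else 0].

Lemma eproj_span P x : eproj P x \in espan P.
Proof. by apply/espanP => A nPA; rewrite ffunE (negPf nPA). Qed.

Lemma eproj_id P x : x \in espan P -> eproj P x = x.
Proof.
by move=> /espanP h; apply/extalg_eqP => A; rewrite ffunE; case: ifPn => // /h.
Qed.

(** Truncation only erases coefficients. With [P] a degree and [Q] a weight this makes the weight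
    blocks graded; with the roles exchanged, weight projections preserve degree. *)
Lemma eproj_preserves_span P Q x : x \in espan Q -> eproj P x \in espan Q.
Proof. by move=> /espanP h; apply/espanP => A /h; rewrite ffunE => ->; case: ifP. Qed.

Lemma ecomp_eproj k x : ecomp k x = eproj (fun A => #|A| == k) x.
Proof.
have /eqP -> := eproj_span (fun A => #|A| == k) x.
by apply: eq_bigr => A hA; rewrite ffunE hA.
Qed.

Lemma graded_espan P : graded_subgroup (espan P).
Proof. by move=> x k hx; rewrite ecomp_eproj; apply: eproj_preserves_span. Qed.

Definition eproj_sub P x : subgroup (espan P) := Subgroup (eproj_span P x).

Lemma eproj_sub_is_zmod_morphism P : zmod_morphism (eproj_sub P).
Proof.
move=> x y; apply/val_inj/extalg_eqP => A; rewrite raddfB /= extB !ffunE.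
by case: ifP; rewrite ?subr0.
Qed.

HB.instance Definition _ P :=
  GRing.isZmodMorphism.Build (extalg n) (subgroup (espan P)) (eproj_sub P)
    (eproj_sub_is_zmod_morphism P).

End Span.

(** * The weight decomposition of the exterior algebra *)

Section WeightDecomposition.
Variables (n : nat) (K : fieldType) (V : lmodType K) (Rp : n.-tuple V).
Implicit Types (x : extalg n) (A B : {set 'I_n}) (a : Omega Rp).

Lemma weight_Omega A : weight Rp A \in [seq weight Rp s | s : {set 'I_n}].
Proof. by apply/mapP; exists A; rewrite ?mem_enum. Qed.

(** Every subset has exactly one weight, so the weight blocks partition the basis. *)
Lemma Lambda_biproduct :
  biproduct (fun a => val : {additive subgroup (Lambda a) -> extalg n})
            (fun a => eproj_sub (fun s => weight Rp s == ssval a)).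
Proof.
split=> [a x|a b x ab|x].
- by apply: val_inj; apply: eproj_id; apply: valP.
- apply/val_inj/extalg_eqP => A; rewrite ffunE ext0; case: eqP => // hA.
  move/espanP: (valP x); apply; apply: contra ab.
  by rewrite hA => /eqP/val_inj ->.
- apply/extalg_eqP => A; rewrite ext_sum.
  (* The only projection that keeps the coefficient at [A] is the one indexed by the weight of
     [A]. *)
  rewrite (bigD1 (SeqSub (weight_Omega A))) //= ffunE eqxx big1 ?addr0 // => a na.
  by rewrite ffunE; case: ifP => // /eqP h; case/eqP: na; apply: val_inj.
Qed.

(** * Stability of the weight blocks under both differentials *)

Section Differentials.
Variables (zbr : freeZ n -> freeZ n -> freeZ n) (zbrP : root_bracket Rp zbr).

Lemma root_bracket_support i j l :
  zbr (zbas i) (zbas j) l != 0 -> tnth Rp i + tnth Rp j = tnth Rp l.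
Proof.
have [hin hout] := zbrP i j.
have [/tnthP[k hk]|/hout ->] := boolP (tnth Rp i + tnth Rp j \in Rp); last first.
  by rewrite ffunE.
by case: (hin k hk) => ->; rewrite !ffunE; case: (l =P k) => [->|].
Qed.

(** Trading two roots of a subset for their sum leaves the sum over the subset unchanged. *)
Lemma weight_exchange A i j l :
  i \in A -> j \in A :\ i -> l \notin A :\ i :\ j ->
  tnth Rp i + tnth Rp j = tnth Rp l ->
  weight Rp (l |: (A :\ i :\ j)) = weight Rp A.
Proof.
move=> iA jA lA h; congr (_ - _); rewrite big_setU1 //= -h.
by rewrite [RHS](big_setD1 i) //= [in RHS](big_setD1 j) //= addrA.
Qed.

Hypothesis zbrL : lie_ring zbr.

Lemma ediff_ebas_weight A :
  ediff zbr (ebas A) \in espan (fun B => weight Rp B == weight Rp A).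
Proof.
(* The contraction formula sums over pairs of generators instead of positions in [enum A]; a pair
   not contained in [A] contributes 0. *)
rewrite (ediff_opE zbrL) /ediff_op.
apply: rpred_sum => i _; apply: rpred_sum => j _.
rewrite econtr_ebas; case: ifP => iA; last by rewrite raddf0 mulr0 rpred0.
rewrite raddfMz /= econtr_ebas; case: ifP => jA; last by rewrite mul0rz mulr0 rpred0.
rewrite mulrzAr rpredMz // mulrzAr rpredMz // /elin mulr_suml.
apply: rpred_sum => l _; rewrite mulrzAl.
have [->|/root_bracket_support h] := eqVneq (zbr (zbas i) (zbas j) l) 0.
  by rewrite mulr0z rpred0.
(* If the root [l] is still present after both contractions, the product repeats a generator and
   vanishes; otherwise [weight_exchange] applies. *)
rewrite rpredMz // egenM_ebas; case: ifPn => lA; first exact: rpred0.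
by rewrite rpredMz // ebas_span // weight_exchange.
Qed.

Lemma Lambda_ediff a : is_subcomplex (C := ext_chain zbrL) (Lambda a).
Proof.
move=> x hx; rewrite [cdif x]/= (eqP hx) raddf_sum.
apply: rpred_sum => A /eqP hA; rewrite raddfMz rpredMz //=.
by rewrite /Lambda -hA ediff_ebas_weight.
Qed.

(** The transpose of a block diagonal matrix is block diagonal: for [A] outside the block, a term
    indexed by [B] dies because either [x B] is 0 or [B] and [A] have different weights. *)
Lemma Lambda_ecodiff a : is_subcomplex (C := ext_cochain zbrL) (Lambda a).
Proof.
move=> x /espanP hx; apply/espanP => A hA; rewrite ffunE big1 // => B _.
have [hB|/hx->] := boolP (weight Rp B == ssval a); last by rewrite mul0r.
have /espanP -> := ediff_ebas_weight A; first by rewrite mulr0.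
by rewrite (eqP hB) eq_sym.
Qed.

End Differentials.

End WeightDecomposition.

Arguments Lambda_ediff {n K V Rp zbr} zbrP zbrL a _ _.
Arguments Lambda_ecodiff {n K V Rp zbr} zbrP zbrL a _ _.

Theorem theorem3p2 (R : realType) (L : vectType R[i]) (br : L -> L -> L)
    (brL : lie_algebra br) (ss : semisimple br)
    (H : {vspace L}) (HC : cartan_subalgebra br H)
    (n : nat) (Rp : n.-tuple 'Hom(subvs_of H, R[i]^o))
    (RpP : positive_roots br Rp)
    (zbr : freeZ n -> freeZ n -> freeZ n) (zbrL : lie_ring zbr)
    (zbrP : root_bracket Rp zbr) :
  [/\ is_graded_direct_sum
        (fun (a : Omega Rp) k (x : subgroup (Lambda a)) => val x \in edeg k)
        (fun k (x : extalg n) => x \in edeg k)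
        (fun a : Omega Rp => val : {additive subgroup (Lambda a) -> extalg n}),
      forall a : Omega Rp, graded_subgroup (Lambda a) &
      exists (dW : forall a : Omega Rp, is_subcomplex (C := ext_chain zbrL) (Lambda a))
             (deltaW : forall a : Omega Rp, is_subcomplex (C := ext_cochain zbrL) (Lambda a)),
        [/\ is_complex_direct_sum (fun a => subcomplex_incl (dW a)),
            is_complex_direct_sum (fun a => subcomplex_incl (deltaW a)) &
            forall F : zmodType,
              is_homology_direct_sum
                (fun a => tensor_map F (subcomplex_incl (dW a))) /\
              is_homology_direct_sum
                (fun a => tensor_map F (subcomplex_incl (deltaW a)))]].
Proof.
(* The chain and cochain complexes share their group and degrees, so [edegC] and [edegP] serve for
   both. *)
have edegC : deg_add_closed (ext_chain zbrL).
  by split=> [k|k x y]; [apply: rpred0 | apply: rpredD].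
have edegP (a : Omega Rp) k (x : extalg n) : x \in edeg k ->
    eproj (fun s => weight Rp s == ssval a) x \in edeg k.
  exact: eproj_preserves_span.
have [q qP] := subcomplex_biproduct (C := ext_chain zbrL)
  (Lambda_ediff zbrP zbrL) (Lambda_biproduct Rp) edegC edegP.
have [r rP] := subcomplex_biproduct (C := ext_cochain zbrL)
  (Lambda_ecodiff zbrP zbrL) (Lambda_biproduct Rp) edegC edegP.
(* The graded decomposition of the group is, up to conversion, the one underlying the decomposition
   of the chain complex. *)
split; first exact: (complex_biproduct_direct_sum qP).
  by move=> a; apply: graded_espan.
exists (Lambda_ediff zbrP zbrL), (Lambda_ecodiff zbrP zbrL); split.
- exact: complex_biproduct_direct_sum qP.
- exact: complex_biproduct_direct_sum rP.
- by move=> F; split; apply: homology_biproduct_direct_sum;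
    apply: tensor_complex_biproduct; [exact: qP | exact: rP].
Qed.
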